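(* Let $(\varphi,E,\eta)$ be a (classical) normal almost para-contact structure on an odd-dimensional smooth manifold $M$. Then the generalized almost para-contact structure $(\mathcal Z,\xi,\pi,\sigma,F)$ associated to it, namely $F=\varphi$, $\pi=0$, $\sigma=0$, $\mathcal Z=E$, $\xi=\eta$, is a strong generalized para-contact structure.
   Context: An almost para-contact structure $(\varphi,E,\eta)$ on a $(2n+1)$-dimensional smooth manifold $M$ consists of a $(1,1)$-tensor field $\varphi$, a vector field $E$ and a 1-form $\eta$ with $\varphi(E)=0$, $\eta\circ\varphi=0$, $\eta(E)=1$, $\varphi^2=\mathrm{id}-\eta\otimes E$, such that $\varphi$ induces an almost paracomplex structure on each fibre of the distribution $\mathcal D=\ker\eta$. It is normal if $$N_\varphi(X,Y)=2d\eta(X,Y)E,\qquad L_E\eta=0,\qquad L_E\varphi=0,$$ where $N_\varphi(X,Y)=[\varphi X,\varphi Y]+\varphi^2[X,Y]-\varphi[\varphi X,Y]-\varphi[X,\varphi Y]$, with the convention $2d\eta(X,Y)=X\eta(Y)-Y\eta(X)-\eta([X,Y])$. $TM\oplus TM^*$ carries the pairing $\langle X+\alpha,Y+\beta\rangle=\frac12(i_X\beta+i_Y\alpha)$ and the Courant bracket $\llbracket (X,\alpha),(Y,\beta)\rrbracket=[X,Y]+L_X\beta-L_Y\alpha-\frac12 d(i_X\beta-i_Y\alpha)$, where this last formula uses the usual exterior derivative of functions. A generalized almost para-contact structure on $M$, represented by $(\mathcal Z,\xi,\pi,\sigma,F)$, consists of a bundle endomorphism $\mathcal F=\begin{pmatrix}F&\pi^\sharp\\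 \sigma_\sharp&-F^*\end{pmatrix}$ of $TM\oplus TM^*$ ($F:TM\to TM$ a bundle map with dual $F^*$, $\pi$ a bivector field, $\sigma$ a 2-form, $\beta(\pi^\sharp\alpha)=\pi(\alpha,\beta)$, $\sigma_\sharp(X)(Y)=\sigma(X,Y)$) and a section $\mathcal Z+\xi$ such that $\mathcal F+\mathcal F^*=0$ (adjoint with respect to $\langle\,,\rangle$), $\xi(\mathcal Z)=1$, $\mathcal F(\xi)=0$, $\mathcal F(\mathcal Z)=0$, $\mathcal F^2=\mathcal I-\mathcal Z\odot\xi$, where $(\mathcal Z\odot\xi)(X+\alpha)=\xi(X)\mathcal Z+\alpha(\mathcal Z)\xi$. The structure associated to $(\varphi,E,\eta)$ has $\mathcal F=\begin{pmatrix}\varphi&0\\0&-\varphi^*\end{pmatrix}$, $\mathcal Z=E$, $\xi=\eta$. The subscript $\mathbb C$ denotes paracomplexification (tensoring with $\mathbb R[e]$, $e^2=1$), and $\mathcal F$, $\langle\,,\rangle$, $\llbracket\,,\rrbracket$ are extended para-complex (bi)linearly. $\ker\xi\subset TM$ and $\ker\mathcal Z\subset TM^*$ are the pointwise kernels of $\xi$ and of evaluation on $\mathcal Z$; $L_{\mathcal Z}$, $L_\xi$ are the line bundles spanned by $\mathcal Z$, $\xi$ (paracomplexified as subbundles of $(TM\oplus TM^* )_{\mathbb C}$); $$E^{(1,0)}=\{\mathcal X+e\mathcal F\mathcal X\},\quad E^{(0,1)}=\{\mathcal X-e\mathcal F\mathcal X\},\quad \mathcal X\in\Gamma(\ker\mathcal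 Z\oplus\ker\xi);$$ $L=L_{\mathcal Z}\oplus E^{(1,0)}$ and $L^*=L_\xi\oplus E^{(0,1)}$. A generalized almost para-contact structure is a strong generalized para-contact structure if both $\Gamma(L)$ and $\Gamma(L^* )$ are closed under the Courant bracket. *)

(* Defs.v *)
From HB Require Import structures.
From mathcomp Require Import all_boot all_order all_algebra.
From mathcomp Require Import all_classical all_reals all_analysis.
From mathcomp Require Import ring.

Set Implicit Arguments.
Unset Strict Implicit.
Unset Printing Implicit Defensive.

Import Order.TTheory GRing.Theory Num.Theory.
Import numFieldNormedType.Exports.

Local Open Scope classical_set_scope.
Local Open Scope ring_scope.

Section Smooth.
Context {R : realType} {m : nat}.
Implicit Types (U : set 'rV[R]_m) (f g : 'rV[R]_m -> R).

(* All iterated partial derivatives of order at most k exist and are continuous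
   on U. *)
Fixpoint Ck (k : nat) U f : Prop :=
  (forall x, U x -> {for x, continuous f}) /\
  (if k is k'.+1 then
     forall j : 'I_m, (forall x, U x -> derivable f x (delta_mx 0 j)) /\
       Ck k' U (fun x => 'D_(delta_mx 0 j) f x)
   else True).

Definition smooth_on U f : Prop := forall k, Ck k U f.

Lemma Ck_cont k U f : Ck k U f -> forall x, U x -> {for x, continuous f}.
Proof. by case: k => [|k] []. Qed.

Lemma Ck_le k U f : Ck k.+1 U f -> Ck k U f.
Proof.
elim: k f => [|k IH] f [fc fd]; split => // j.
by have [d1 d2] := fd j; split => //; apply: IH.
Qed.

Lemma Ck_ext k U f g : open U -> (forall x, U x -> f x = g x) ->
  Ck k U f -> Ck k U g.
Proof.
move=> oU; elim: k f g => [|k IH] f g fg.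
all: have nfg x : U x -> \forall y \near x, f y = g y
  by move=> Ux; have := open_nbhs_nbhs (conj oU Ux); apply: filterS => y /fg.
all: have gc : (forall x, U x -> {for x, continuous f}) ->
  (forall x, U x -> {for x, continuous g})
  by move=> fc x Ux; have := fc x Ux;
     rewrite /prop_for /continuous_at -(fg x Ux); apply: cvg_trans;
     exact: near_eq_cvg (nfg x Ux).
  by case=> /gc ? _; split.
case=> /gc gc' fd; split => // j; have [d1 d2] := fd j; split.
  move=> x Ux; apply: near_eq_derivable (d1 x Ux) => //; first exact: nfg.
apply: IH d2 => x Ux; apply: near_eq_derive => //; exact: nfg.
Qed.

Lemma Ck_cst k U (a : R) : Ck k U (cst a).
Proof.
elim: k a => [|k IH] a; split => //.
1,2: by move=> x _; exact: cst_continuous.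
move=> j; split=> [x _|]; first exact: derivable_cst.
rewrite (_ : (fun x => _) = cst 0) //.
by apply/funext => x; rewrite derive_cst.
Qed.

Lemma CkD k U f g : open U -> Ck k U f -> Ck k U g -> Ck k U (f + g).
Proof.
move=> oU; elim: k f g => [|k IH] f g [fc fd] [gc gd]; split => //.
1,2: by move=> x Ux; apply: continuousD; [exact: fc|exact: gc].
move=> j; have [df fd'] := fd j; have [dg gd'] := gd j; split=> [x Ux|].
  by apply: derivableD; [exact: df|exact: dg].
apply: Ck_ext (IH _ _ fd' gd') => // x Ux.
by rewrite deriveD //; [exact: df|exact: dg].
Qed.

Lemma CkM k U f g : open U -> Ck k U f -> Ck k U g -> Ck k U (f * g).
Proof.
move=> oU; elim: k f g => [|k IH] f g fk gk.
all: have [fc fd] := fk; have [gc gd] := gk; split => //.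
1,2: by move=> x Ux; apply: continuousM; [exact: fc|exact: gc].
move=> j; have [df fd'] := fd j; have [dg gd'] := gd j; split=> [x Ux|].
  by apply: derivableM; [exact: df|exact: dg].
apply: Ck_ext (CkD oU (IH _ _ (Ck_le fk) gd') (IH _ _ (Ck_le gk) fd')) => //.
by move=> x Ux; rewrite deriveM //; [exact: df|exact: dg].
Qed.

End Smooth.

Section Manifold.
Context (R : realType) (m : nat).

Record chart (T : topologicalType) := Chart {
  chart_dom : set T;
  chart_cod : set 'rV[R]_m;
  chart_map : T -> 'rV[R]_m;
  chart_inv : 'rV[R]_m -> T;
  chart_dom_open : open chart_dom;
  chart_cod_open : open chart_cod;
  chart_mapP : forall x, chart_dom x -> chart_cod (chart_map x);
  chart_invP : forall y, chart_cod y -> chart_dom (chart_inv y);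
  chart_mapK : forall x, chart_dom x -> chart_inv (chart_map x) = x;
  chart_invK : forall y, chart_cod y -> chart_map (chart_inv y) = y;
  chart_map_cont : forall x, chart_dom x -> {for x, continuous chart_map};
  chart_inv_cont : forall y, chart_cod y -> {for y, continuous chart_inv} }.

(* The atlas need not be maximal: smoothness of a function does not change when
   the atlas is completed. *)
Record manifold := Manifold {
  carrier :> topologicalType;
  atlas : set (chart carrier);
  manifold_hausdorff : hausdorff_space carrier;
  manifold_countable : @second_countable carrier;
  atlas_cover : forall x : carrier, exists2 c, atlas c & chart_dom c x;
  atlas_compat : forall c c', atlas c -> atlas c' -> forall i : 'I_m,
    smooth_on (chart_cod c `&` chart_inv c @^-1` chart_dom c')
              (fun y => chart_map c' (chart_inv c y) 0 i) }.

End Manifold.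

Section SmoothFunctions.
Context {R : realType} {m : nat} (M : manifold R m).

Definition smooth_pred : pred (M -> R^o) := fun f =>
  `[< forall c, @atlas R m M c -> smooth_on (chart_cod c) (f \o chart_inv c) >].

Lemma smooth_subring : subring_closed smooth_pred.
Proof.
have sC a : cst a \in smooth_pred.
  by apply/asboolP => c _ k; exact: Ck_cst.
have sM f g : f \in smooth_pred -> g \in smooth_pred -> f * g \in smooth_pred.
  move=> /asboolP sf /asboolP sg; apply/asboolP => c Mc k.
  by apply: CkM; [exact: chart_cod_open|exact: sf|exact: sg].
split => //; first exact: sC.
move=> f g sf sg; rewrite -[g]mul1r -mulNr.
have /asboolP sg' : cst (-1) * g \in smooth_pred by exact: sM.
move/asboolP: sf => sf; apply/asboolP => c Mc k.
apply: Ck_ext (CkD (@chart_cod_open _ _ _ c) (sf c Mc k) (sg' c Mc k)) => //.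
exact: chart_cod_open.
Qed.

Lemma smooth_scale : GRing.scaler_closed smooth_pred.
Proof.
move=> a f /asboolP sf; apply/asboolP => c Mc k.
by apply: (CkM (@chart_cod_open _ _ _ c) (Ck_cst k _ a) (sf c Mc k)).
Qed.

HB.instance Definition _ :=
  GRing.isSubringClosed.Build (M -> R^o) smooth_pred smooth_subring.
HB.instance Definition _ :=
  GRing.isScaleClosed.Build R (M -> R^o) smooth_pred smooth_scale.

Record smoothfun := SmoothFun {
  smoothfun_val :> M -> R^o;
  smoothfunP : smoothfun_val \in smooth_pred }.

HB.instance Definition _ := [isSub for smoothfun_val].
HB.instance Definition _ := [Choice of smoothfun by <:].
HB.instance Definition _ := 
  GRing.SubChoice_isSubComPzRing.Build _ _ smoothfun (subringClosedP _).
HB.instance Definition _ := [SubZmodule_isSubLmodule of smoothfun by <:].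

End SmoothFunctions.

Arguments smoothfun {R m} M.

Section Fields.
Context {R : realType} {m : nat} (M : manifold R m).
Local Notation C := (smoothfun M).

(* As in Helgason's "Differential Geometry, Lie Groups, and Symmetric Spaces",
   I.2-3: a vector field is an R-linear derivation of the algebra C of smooth
   functions, a 1-form is a C-linear map from vector fields to C, and a bundle
   map between (sums of) TM and TM^* is a C-linear map between the modules of
   sections.  C^o is C seen as a module over itself. *)
Definition derivation_pred : pred (C -> C^o) := fun X =>
  `[< linear (X : C -> C) /\ forall f g : C, X (f * g) = f * X g + g * X f >].

Lemma derivation_submod : submod_closed derivation_pred.
Proof.
split=> [|h X Y /asboolP[lX pX] /asboolP[lY pY]]; apply/asboolP; split.
- by move=> a f g; rewrite scaler0 addr0.
- by move=> f g; rewrite !mulr0 addr0.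
- move=> a f g; change (h * X (a *: f + g) + Y (a *: f + g) =
    a *: (h * X f + Y f) + (h * X g + Y g) :> C).
  rewrite lX lY mulrDr scalerDr addrACA; congr (_ + _ + _).
  by apply/val_inj/funext => x; exact: mulrCA.
- move=> f g; change (h * X (f * g) + Y (f * g) =
    f * (h * X g + Y g) + g * (h * X f + Y f) :> C).
  by rewrite pX pY; ring.
Qed.

HB.instance Definition _ :=
  GRing.isSubmodClosed.Build C (C -> C^o) derivation_pred derivation_submod.

Record vfield := VField {
  vfield_val :> C -> C^o;
  vfieldP : vfield_val \in derivation_pred }.

HB.instance Definition _ := [isSub for vfield_val].
HB.instance Definition _ := [Choice of vfield by <:].
HB.instance Definition _ := [SubChoice_isSubLmodule of vfield by <:].

Definition form_pred : pred (vfield -> C^o) := fun a => `[< linear a >].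

Lemma form_submod : submod_closed form_pred.
Proof.
split=> [|h a b /asboolP la /asboolP lb]; apply/asboolP => f X Y.
  by rewrite scaler0 addr0.
change (h * a (f *: X + Y) + b (f *: X + Y) =
  f * (h * a X + b X) + (h * a Y + b Y) :> C).
by rewrite la lb /GRing.scale /=; ring.
Qed.

HB.instance Definition _ :=
  GRing.isSubmodClosed.Build C (vfield -> C^o) form_pred form_submod.

Record oneform := OneForm {
  oneform_val :> vfield -> C^o;
  oneformP : oneform_val \in form_pred }.

HB.instance Definition _ := [isSub for oneform_val].
HB.instance Definition _ := [Choice of oneform by <:].
HB.instance Definition _ := [SubChoice_isSubLmodule of oneform by <:].

Lemma vfield_linear (X : vfield) : linear (X : C -> C).
Proof. by have /asboolP[] := vfieldP X. Qed.

Lemma vfieldM (X : vfield) (f g : C) : X (f * g) = f * X g + g * X f.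
Proof. by have /asboolP[_] := vfieldP X. Qed.

Lemma vfieldD (X : vfield) (f g : C) : X (f + g) = X f + X g.
Proof. by have := vfield_linear X 1 f g; rewrite !scale1r. Qed.

Lemma vfieldB (X : vfield) (f g : C) : X (f - g) = X f - X g.
Proof.
by have := vfield_linear X (-1) g f; rewrite !scaleN1r ![- _ + _]addrC.
Qed.

Lemma oneform_linear (a : oneform) : linear a.
Proof. exact/asboolP/oneformP. Qed.

HB.instance Definition _ (a : oneform) :=
  GRing.isLinear.Build C vfield C^o *:%R a (oneform_linear a).

Lemma bracket_subproof (X Y : vfield) :
  (fun f : C => X (Y f) - Y (X f) : C^o) \in derivation_pred.
Proof.
apply/asboolP; split=> [a f g|f g].
  rewrite !vfield_linear.
  by rewrite scalerBr addrACA opprD.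
by rewrite !(vfieldM, vfieldD); ring.
Qed.
Definition bracket (X Y : vfield) : vfield := VField (bracket_subproof X Y).

Lemma differential_fun_subproof (f : C) :
  (fun X : vfield => X f) \in form_pred.
Proof. by apply/asboolP => h X Y. Qed.
Definition differential_fun (f : C) : oneform :=
  OneForm (differential_fun_subproof f).

Lemma bracketZD (X : vfield) (f : C) (Y Z : vfield) :
  bracket X (f *: Y + Z) = X f *: Y + f *: bracket X Y + bracket X Z.
Proof.
apply/val_inj/funext => g /=; rewrite !fctE /= /GRing.scale /=.
by rewrite vfieldD vfieldM /= /GRing.scale /=; ring.
Qed.

Lemma lie_form_subproof (X : vfield) (b : oneform) :
  (fun Y : vfield => X (b Y) - b (bracket X Y) : C^o) \in form_pred.
Proof.
apply/asboolP => f Y Z; rewrite bracketZD -addrA !oneform_linear.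
by rewrite vfieldD vfieldM /GRing.scale /=; ring.
Qed.
Definition lie_form (X : vfield) (b : oneform) : oneform :=
  OneForm (lie_form_subproof X b).

Definition lie_endo (X : vfield) (phi : {linear vfield -> vfield}) (Y : vfield)
  : vfield := bracket X (phi Y) - phi (bracket X Y).

Definition half_fun : C := (2^-1 : R) *: (1 : C).

Definition dform (a : oneform) (X Y : vfield) : C :=
  half_fun * (X (a Y) - Y (a X) - a (bracket X Y)).

Lemma dual_subproof (F : {linear vfield -> vfield}) (a : oneform) :
  (fun X : vfield => a (F X)) \in form_pred.
Proof. by apply/asboolP => f X Y; rewrite linearP oneform_linear. Qed.
Definition dual_endo (F : {linear vfield -> vfield}) (a : oneform) : oneform :=
  OneForm (dual_subproof F a).

(* A bivector field pi is given by its map pi^sharp, as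
   pi(a, b) = b (pi^sharp a); a 2-form is given by sigma_sharp. *)
Record bivector := Bivector {
  bivector_sharp :> {linear oneform -> vfield};
  bivector_alt : forall a : oneform, a (bivector_sharp a) = 0 }.

Record twoform := TwoForm {
  twoform_sharp :> {linear vfield -> oneform};
  twoform_alt : forall X : vfield, twoform_sharp X X = 0 }.

Definition bivector0 : bivector := @Bivector \0 (fun a => linear0 a).
Definition twoform0 : twoform := @TwoForm \0 (fun X => erefl).

(* (X, a) : gsection is the section X + a of TM (+) TM^* *)
Definition gsection : Type := (vfield * oneform)%type.

Definition pairing (s t : gsection) : C := half_fun * (t.2 s.1 + s.2 t.1).

Definition courant (s t : gsection) : gsection :=
  (bracket s.1 t.1,
   lie_form s.1 t.2 - lie_form t.1 s.2
   - half_fun *: differential_fun (t.2 s.1 - s.2 t.1)).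

End Fields.

Section ParaContact.
Context {R : realType}.

Definition has_dim (V : lmodType R) (S : set V) (k : nat) : Prop :=
  exists b : 'I_k -> V,
    (forall a : 'I_k -> R, \sum_i a i *: b i = 0 -> forall i, a i = 0) /\
    (forall v, S v <-> exists a : 'I_k -> R, v = \sum_i a i *: b i).

(* The tangent vector X_p, acting on smooth functions; T_p M is the set of all
   the X_p. *)
Definition tangent_at {m} {M : manifold R m} (p : M) (X : vfield M)
  : smoothfun M -> R^o := fun f => (X f : smoothfun M) p.

Section Classical.
Context {n : nat} {M : manifold R n.*2.+1}.
Variables (phi : {linear vfield M -> vfield M}) (E : vfield M) (eta : oneform M).
Implicit Types X Y : vfield M.

(* The eigenspace, for the eigenvalue a, of the endomorphism X_p |-> (phi X)_p
   of the fibre D_p of D = ker eta. *)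
Definition fibre_eigenspace (p : M) (a : R) : set (smoothfun M -> R^o) :=
  [set v | exists X, [/\ eta X = 0, tangent_at p X = v
                       & tangent_at p (phi X) = a *: v]].

(* An almost paracomplex structure on a 2n-dimensional vector space is an
   endomorphism J with J^2 = id whose eigenspaces for 1 and -1 have dimension
   n.  That phi^2 = id on D is a consequence of almost_pc_sqr. *)
Record almost_paracontact : Prop := AlmostParacontact {
  almost_pc_E : phi E = 0;
  almost_pc_eta : forall X, eta (phi X) = 0;
  almost_pc_etaE : eta E = 1;
  almost_pc_sqr : forall X, phi (phi X) = X - (eta X : smoothfun M) *: E;
  almost_pc_fibre : forall p : M,
    has_dim (fibre_eigenspace p 1) n /\ has_dim (fibre_eigenspace p (-1)) n }.

Definition nijenhuis X Y : vfield M :=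
  bracket (phi X) (phi Y) + phi (phi (bracket X Y))
  - phi (bracket (phi X) Y) - phi (bracket X (phi Y)).

Record normal_paracontact : Prop := NormalParacontact {
  normal_nijenhuis : forall X Y, nijenhuis X Y = (2%:R * dform eta X Y) *: E;
  normal_lie_eta : lie_form E eta = 0;
  normal_lie_phi : forall X, lie_endo E phi X = 0 }.

End Classical.

Section Generalized.
Context {m : nat} {M : manifold R m}.
Local Notation C := (smoothfun M).

Record gpc_data := GPCData {
  gpc_Z : vfield M;
  gpc_xi : oneform M;
  gpc_pi : bivector M;
  gpc_sigma : twoform M;
  gpc_F : {linear vfield M -> vfield M} }.

Variable S : gpc_data.
Local Notation Z := (gpc_Z S).
Local Notation xi := (gpc_xi S).
Implicit Types s t : gsection M.

Definition gpc_endo s : gsection M :=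
  (gpc_F S s.1 + gpc_pi S s.2, gpc_sigma S s.1 - dual_endo (gpc_F S) s.2).

Definition gpc_odot s : gsection M :=
  ((xi s.1 : C) *: Z, (s.2 Z : C) *: xi).

Record gen_almost_paracontact : Prop := GenAlmostParacontact {
  gpc_skew : forall s t, pairing (gpc_endo s) t + pairing s (gpc_endo t) = 0;
  gpc_xiZ : xi Z = 1;
  gpc_endo_xi : gpc_endo (0, xi) = 0;
  gpc_endo_Z : gpc_endo (Z, 0) = 0;
  gpc_endo_sqr : forall s, gpc_endo (gpc_endo s) = s - gpc_odot s }.

(* (u, v) : para V stands for u + e v, with e^2 = 1. *)
Definition para (V : Type) : Type := (V * V)%type.
Definition para_real (V : zmodType) (v : V) : para V := (v, 0).
Definition para_e (V : Type) (u : para V) : para V := (u.2, u.1).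
Definition para_map (V W : Type) (f : V -> W) (u : para V) : para W :=
  (f u.1, f u.2).
Definition para_scale (V : lmodType C) (c : para C) (u : para V) : para V :=
  (c.1 *: u.1 + c.2 *: u.2, c.1 *: u.2 + c.2 *: u.1).
Definition para_bilin (U V : Type) (W : zmodType) (f : U -> V -> W)
  (u : para U) (v : para V) : para W :=
  (f u.1 v.1 + f u.2 v.2, f u.1 v.2 + f u.2 v.1).

Implicit Types (u v w : para (gsection M)).

Definition gpc_ker : set (gsection M) := [set s : gsection M | xi s.1 = 0 /\ s.2 Z = 0].

Definition gpc_line s : set (para (gsection M)) :=
  [set u | exists c : para C, u = para_scale c (para_real s)].

Definition gpc_E10 : set (para (gsection M)) :=
  [set u | exists2 s, gpc_ker s &
     u = para_real s + para_e (para_map gpc_endo (para_real s))].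

Definition gpc_E01 : set (para (gsection M)) :=
  [set u | exists2 s, gpc_ker s &
     u = para_real s - para_e (para_map gpc_endo (para_real s))].

Definition gpc_L : set (para (gsection M)) :=
  [set u | exists v w, [/\ gpc_line (Z, 0) v, gpc_E10 w & u = v + w]].

Definition gpc_Lstar : set (para (gsection M)) :=
  [set u | exists v w, [/\ gpc_line (0, xi) v, gpc_E01 w & u = v + w]].

Definition courant_closed (A : set (para (gsection M))) : Prop :=
  forall u v, A u -> A v -> A (para_bilin (@courant R m M) u v).

Definition strong_gen_paracontact : Prop :=
  [/\ gen_almost_paracontact, courant_closed gpc_L & courant_closed gpc_Lstar].

End Generalized.

Definition associated_gpc {m} {M : manifold R m}
  (phi : {linear vfield M -> vfield M}) (E : vfield M) (eta : oneform M)
  : @gpc_data m M := GPCData E eta (bivector0 M) (twoform0 M) phi.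

End ParaContact.

(* Main.v *)
(* For [s], [t] in [ker Z (+) ker xi], the paracomplex bracket of [s + e F s]
   and [t + e F t] has real part [W = [s, t] + [F s, F t]] and e-part
   [[s, F t] + [F s, t]].  The Nijenhuis condition and its eta-component give
   that [W] is again in [ker Z (+) ker xi] and that the e-part is [F W].  Since
   [W] does not change when [F] is replaced by [- F], this settles both
   eigenbundles at once.  Brackets with the line bundles are controlled by
   [L_E phi = 0] and [L_E eta = 0] for [L], and by [L_E eta = 0] and the
   eta-component of the Nijenhuis condition for [L^*]. *)

Require Import Defs.
From mathcomp Require Import all_boot all_order all_algebra.
From mathcomp Require Import all_classical all_reals all_analysis.
From mathcomp Require Import ring.
Import GRing.Theory.
Local Open Scope ring_scope.

(** * Rearrangements of sums in abelian groups and modules *)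

Lemma addr_regroup (V : zmodType) (a b p q x y w v : V) :
  a + p + (- x + w) + (b + q + (- y + v)) = a + b + (p + q) - (x + y) + (w + v).
Proof. by rewrite addrACA (addrACA a) (addrACA (- x)) -opprD !addrA. Qed.

(** Collects the coefficient of [z]; the nested remainder is a combination [f *: s + t] at each
    level, ready for linearity. *)
Lemma scale_regroup (A : pzRingType) (V : lmodType A) (c d e h k : A)
    (z p p' q q' w : V) :
  c *: z + (- d *: z + (p + p')) - (- e *: z + (h *: q + k *: q')) + w
  = (c - d + e) *: z + (p + (p' + (- h *: q + (- k *: q' + w)))).
Proof.
rewrite !scalerDl !scaleNr !opprD opprK !addrA.
by congr (_ + _ + _ + _); rewrite (addrAC _ p') (addrAC _ p).
Qed.

(** * Calculus of Lie derivatives and the Courant bracket *)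

Section Cartan.
Context {R : realType} {m : nat} {M : manifold R m}.
Local Notation C := (smoothfun M).
Implicit Types (f g : C) (X Y : vfield M) (a b : oneform M) (s t : gsection M).

Lemma vfield_ext X Y : (forall f, X f = Y f) -> X = Y.
Proof. by move=> XY; apply/val_inj/funext. Qed.

Lemma oneform_ext a b : (forall X, a X = b X) -> a = b.
Proof. by move=> ab; apply/val_inj/funext. Qed.

Lemma vfield_addE X Y f : (X + Y) f = X f + Y f. Proof. by []. Qed.
Lemma vfield_oppE X f : (- X) f = - X f. Proof. by []. Qed.
Lemma vfield_scaleE f X g : (f *: X) g = f * X g. Proof. by []. Qed.
Lemma vfield_zeroE f : (0 : vfield M) f = 0. Proof. by []. Qed.
Lemma bracketE X Y f : bracket X Y f = X (Y f) - Y (X f). Proof. by []. Qed.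
(** Evaluation turns identities of fields into identities between smooth functions, within reach of
    [ring]. *)
Definition vfieldE :=
  (vfield_addE, vfield_oppE, vfield_scaleE, vfield_zeroE, bracketE).

Lemma vfield0 X : X (0 : C) = 0.
Proof. by apply: (@addrI _ (X (0 : C))); rewrite -vfieldD !addr0. Qed.

Lemma vfieldN X f : X (- f) = - X f.
Proof. by rewrite -sub0r vfieldB vfield0 sub0r. Qed.

Lemma oneform_addE a b X : (a + b) X = a X + b X. Proof. by []. Qed.
Lemma oneform_oppE a X : (- a) X = - a X. Proof. by []. Qed.
Lemma oneform_scaleE f a X : (f *: a) X = f * a X. Proof. by []. Qed.
Lemma oneform_zeroE X : (0 : oneform M) X = 0. Proof. by []. Qed.
Lemma lie_formE X a Y : lie_form X a Y = X (a Y) - a (bracket X Y).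
Proof. by []. Qed.
Lemma differential_funE f X : differential_fun f X = X f. Proof. by []. Qed.
Lemma dual_endoE (F : {linear vfield M -> vfield M}) a X :
  dual_endo F a X = a (F X).
Proof. by []. Qed.
Definition oneformE := (oneform_addE, oneform_oppE, oneform_scaleE,
  oneform_zeroE, lie_formE, differential_funE, dual_endoE).

Lemma oneform_appD a X Y : a (X + Y) = a X + a Y. Proof. exact: raddfD. Qed.
Lemma oneform_appN a X : a (- X) = - a X. Proof. exact: raddfN. Qed.
Lemma oneform_appZ a f X : a (f *: X) = f * a X. Proof. exact: linearZ. Qed.
Lemma oneform_app0 a : a 0 = 0. Proof. exact: raddf0. Qed.
Definition oneform_app :=
  (oneform_appD, oneform_appN, oneform_appZ, oneform_app0).

Lemma bracket_antisym X Y : bracket Y X = - bracket X Y.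
Proof. by apply: vfield_ext => f; rewrite !vfieldE opprB. Qed.

Lemma bracketDr X Y Y' : bracket X (Y + Y') = bracket X Y + bracket X Y'.
Proof.
by apply: vfield_ext => f; rewrite !vfieldE !vfieldD; ring.
Qed.

Lemma bracketZr X f Y : bracket X (f *: Y) = X f *: Y + f *: bracket X Y.
Proof.
by apply: vfield_ext => g; rewrite !vfieldE vfieldM; ring.
Qed.

Lemma bracketDl X X' Y : bracket (X + X') Y = bracket X Y + bracket X' Y.
Proof.
by rewrite bracket_antisym bracketDr opprD -!bracket_antisym.
Qed.

Lemma bracketZl f X Y : bracket (f *: X) Y = f *: bracket X Y - Y f *: X.
Proof.
by rewrite bracket_antisym bracketZr opprD addrC -scalerN -bracket_antisym.
Qed.

Lemma bracket0r X : bracket X 0 = 0.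
Proof. by have := bracketZr X 0 0; rewrite !scaler0 scale0r addr0. Qed.

Lemma bracket0l X : bracket 0 X = 0.
Proof. by rewrite bracket_antisym bracket0r oppr0. Qed.

Lemma lie_formDr X a b : lie_form X (a + b) = lie_form X a + lie_form X b.
Proof.
by apply: oneform_ext => Y; rewrite !oneformE vfieldD; ring.
Qed.

Lemma lie_formZr X f a : lie_form X (f *: a) = X f *: a + f *: lie_form X a.
Proof.
by apply: oneform_ext => Y; rewrite !oneformE vfieldM; ring.
Qed.

Lemma lie_form0r X : lie_form X 0 = 0.
Proof. by have := lie_formZr X 0 0; rewrite !scaler0 scale0r addr0. Qed.

Lemma lie_formDl X Y a : lie_form (X + Y) a = lie_form X a + lie_form Y a.
Proof.
apply: oneform_ext => Z.
by rewrite !oneformE !vfieldE bracketDl oneform_app; ring.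
Qed.

Lemma lie_formZl f X a :
  lie_form (f *: X) a = f *: lie_form X a + a X *: differential_fun f.
Proof.
apply: oneform_ext => Z.
by rewrite !oneformE !vfieldE bracketZl !oneform_app; ring.
Qed.

Lemma lie_form0l a : lie_form 0 a = 0.
Proof.
apply: oneform_ext => Y.
by rewrite !oneformE bracket0l oneform_app vfieldE subr0.
Qed.

Lemma differential_fun0 : differential_fun (0 : C) = 0.
Proof. by apply: oneform_ext => Y; rewrite !oneformE vfield0. Qed.

Lemma courant_antisym s t : courant t s = - courant s t.
Proof.
congr pair; first exact: bracket_antisym.
apply: oneform_ext => X; rewrite !oneformE /= !(vfieldB, vfieldD, vfieldN).
by ring.
Qed.

(** Additivity only: function coefficients produce derivative terms, which are tracked separately
    for multiples of [z]. *)
Lemma courantDr s t t' : courant s (t + t') = courant s t + courant s t'.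
Proof.
congr pair; first exact: bracketDr.
rewrite /= lie_formDr lie_formDl.
apply: oneform_ext => X.
by rewrite !oneformE !oneform_app !(vfieldB, vfieldD, vfieldN); ring.
Qed.

Lemma courantDl s s' t : courant (s + s') t = courant s t + courant s' t.
Proof. by rewrite courant_antisym courantDr opprD -!courant_antisym. Qed.

Lemma bracket_diag X : bracket X X = 0.
Proof. by apply: vfield_ext => f; rewrite !vfieldE subrr. Qed.

Lemma vfield1 X : X (1 : C) = 0.
Proof.
have := vfieldM X 1 1; rewrite !mul1r => e.
by apply: (@addrI _ (X (1 : C))); rewrite addr0.
Qed.

Lemma lie_formNl X a : lie_form (- X) a = - lie_form X a.
Proof.
apply/eqP; rewrite -addr_eq0 -lie_formDl addNr; apply/eqP.
exact: lie_form0l.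
Qed.

Lemma courant0r s : courant s 0 = 0.
Proof.
by apply: (@addrI _ (courant s 0)); rewrite -courantDr !addr0.
Qed.

Lemma courantNr s t : courant s (- t) = - courant s t.
Proof. by apply/eqP; rewrite -addr_eq0 -courantDr addNr courant0r. Qed.

End Cartan.

(** * Courant closure of a line plus the graph of an involution *)

Section ParaGraph.
Context {R : realType} {m : nat} {M : manifold R m}.
Local Notation C := (smoothfun M).
Implicit Types (f g h k : C) (X Y : vfield M) (a b : oneform M)
  (s t z : gsection M).

Lemma gsection_fstD s t : (s + t).1 = s.1 + t.1. Proof. by []. Qed.
Lemma gsection_fstZ f s : (f *: s).1 = f *: s.1. Proof. by []. Qed.
Lemma gsection_sndD s t : (s + t).2 = s.2 + t.2. Proof. by []. Qed.
Lemma gsection_sndZ f s : (f *: s).2 = f *: s.2. Proof. by []. Qed.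
Definition gsectionE :=
  (gsection_fstD, gsection_fstZ, gsection_sndD, gsection_sndZ).

Lemma courantE X a Y b : courant (X, a) (Y, b)
  = (bracket X Y, lie_form X b - lie_form Y a
     - half_fun M *: differential_fun (b X - a Y)).
Proof. by []. Qed.

Lemma gsection_pairD X a Y b : (X, a) + (Y, b) = (X + Y, a + b) :> gsection M.
Proof. by []. Qed.

Lemma pair_scale0r f a : f *: ((0, a) : gsection M) = (0, f *: a).
Proof. by congr pair; rewrite scaler0. Qed.

Lemma pair_scaleE0 f X : f *: ((X, 0) : gsection M) = (f *: X, 0).
Proof. by congr pair; rewrite scaler0. Qed.

Lemma para_line_addE (c : para C) s t t' :
  para_scale c (para_real s) + (t, t') = (c.1 *: s + t, c.2 *: s + t').
Proof. by rewrite /para_scale /= !scaler0 addr0 add0r. Qed.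

(** The sections [(f + e g) z + (s + e F s)] with [s] in [K]: both [gpc_L] and [gpc_Lstar] have this
    form, for opposite signs of [F]. *)
Definition para_graph z (K : gsection M -> Prop) (F : gsection M -> gsection M)
    : para (gsection M) -> Prop :=
  fun u => exists f g s, K s /\ u = (f *: z + s, g *: z + F s).

(* [D s] is the component of [courant z s] transverse to the line of [z]. *)
Lemma para_graph_closed z (K : gsection M -> Prop)
    (F D : gsection M -> gsection M) :
  (forall f s t, K s -> K t -> K (f *: s + t)) ->
  linear F ->
  (forall s, K s -> K (F s)) -> (forall s, K s -> F (F s) = s) ->
  (forall f g, exists c, courant (f *: z) (g *: z) = c *: z) ->
  (forall f s, K s -> courant (f *: z) s = - s.1 f *: z + f *: D s) ->
  (forall s, K s -> K (D s)) -> (forall s, K s -> D (F s) = F (D s)) ->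
  (forall s t, K s -> K t -> K (courant s t + courant (F s) (F t)) /\
    courant s (F t) + courant (F s) t = F (courant s t + courant (F s) (F t)))
  -> courant_closed (para_graph z K F).
Proof.
move=> Klin Flin KF FF zz zs KD DF core _ _
  [f [g [s [Ks ->]]]] [h [k [t [Kt ->]]]].
have [KW FW] := core s t Ks Kt.
(* Real part of the bracket of [(f' + e g') z] with [r + e F r]; exchanging [f'] and [g'] gives the
   e-part. *)
have Dline f' g' r : K r ->
    courant (f' *: z) r + courant (g' *: z) (F r)
    = - (r.1 f' + (F r).1 g') *: z + (f' *: D r + g' *: F (D r)).
  move=> Kr; rewrite !zs; try exact: KF; try by [].
  by rewrite DF // opprD scalerDl addrACA.
have [c1 e1] := zz f h; have [c2 e2] := zz g k.
have [c3 e3] := zz f k; have [c4 e4] := zz g h.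
(* The coefficients of [z] come from brackets within the line and from derivatives of [f], [g], [h],
   [k] along the other section. *)
exists (c1 + c2 - (t.1 f + (F t).1 g) + (s.1 h + (F s).1 k)).
exists (c3 + c4 - (t.1 g + (F t).1 f) + (s.1 k + (F s).1 h)).
(* The transverse part of the real component. *)
exists (f *: D t + (g *: F (D t) + ((- h) *: D s + ((- k) *: F (D s)
        + (courant s t + courant (F s) (F t)))))).
have [KDs KDt] := (KD s Ks, KD t Kt).
split.
  apply: (Klin) => //; apply: (Klin); first exact: KF.
  by apply: (Klin) => //; apply: (Klin) => //; exact: KF.
(* [F] of the witness is computed termwise, and [FW] read backwards supplies the mixed brackets of
   the e-component. *)
rewrite !Flin !FF // -FW /para_bilin /=.
rewrite !courantDl !courantDr e1 e2 e3 e4.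
rewrite !(courant_antisym (_ *: z) s) !(courant_antisym (_ *: z) (F s)).
have d1 := Dline f g t Kt; have d2 := Dline g f t Kt.
have d3 := Dline h k s Ks; have d4 := Dline k h s Ks.
congr pair.
- by rewrite addr_regroup d1 d3 -(scalerDl z c1) scale_regroup.
- rewrite addr_regroup (addrC (courant (f *: z) _)) d2 d4.
  rewrite (addrC (g *: D t)) (addrC (k *: D s)).
  by rewrite -(scalerDl z c3) scale_regroup.
Qed.

End ParaGraph.

(** * Consequences of normality *)

Section Normal.
Context {R : realType} {n : nat} {M : manifold R n.*2.+1}.
Local Notation C := (smoothfun M).
Context {phi : {linear vfield M -> vfield M}} {E : vfield M} {eta : oneform M}.
Context (ac : almost_paracontact phi E eta) (nc : normal_paracontact phi E eta).
Implicit Types (f g : C) (X Y : vfield M) (a b : oneform M) (s t : gsection M).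

Let etaE : eta E = 1 := almost_pc_etaE ac.
Let phiE : phi E = 0 := almost_pc_E ac.
Let eta_phi X : eta (phi X) = 0 := almost_pc_eta ac X.

Lemma phi_sqr_ker X : eta X = 0 -> phi (phi X) = X.
Proof. by move=> X0; rewrite (almost_pc_sqr ac) X0 scale0r subr0. Qed.

Lemma oneform_phi_sqr a X : a E = 0 -> a (phi (phi X)) = a X.
Proof.
by move=> a0; rewrite (almost_pc_sqr ac) !oneform_app a0 mulr0 subr0.
Qed.

(** Clears the factor one half built into [dform]. *)
Lemma half_funK (f : C) : 2%:R * (half_fun M * f) = f.
Proof.
rewrite mulrA mulr_natl -scaler_nat scalerA divff ?Num.Theory.pnatr_eq0 //.
by rewrite scale1r mul1r.
Qed.

(** [Y] stays outside [ker eta] because identities of 1-forms are tested below on arbitrary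
    fields. *)
Lemma nijenhuis_ker X Y : eta X = 0 ->
  bracket (phi X) (phi Y) + phi (phi (bracket X Y))
  - phi (bracket (phi X) Y) - phi (bracket X (phi Y))
  = (X (eta Y) - eta (bracket X Y)) *: E.
Proof.
move=> X0; have := normal_nijenhuis nc X Y.
by rewrite /nijenhuis /dform half_funK X0 vfield0 subr0.
Qed.

(** Apply [eta] to the Nijenhuis condition: the terms in the image of [phi] vanish. *)
Lemma eta_bracket_phi X Y : eta X = 0 ->
  eta (bracket (phi X) (phi Y)) = X (eta Y) - eta (bracket X Y).
Proof.
move=> X0; have := congr1 eta (nijenhuis_ker X Y X0).
by rewrite !oneform_app !eta_phi etaE !subr0 addr0 mulr1.
Qed.

(** The previous identity with [phi X] in place of [X], since [phi (phi X) = X]. *)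
Lemma eta_bracket_phi_sum X Y : eta X = 0 ->
  eta (bracket (phi X) Y) + eta (bracket X (phi Y)) = phi X (eta Y).
Proof.
move=> X0; have := eta_bracket_phi (phi X) Y (eta_phi X).
by rewrite phi_sqr_ker // => ->; rewrite addrC subrK.
Qed.

(** Apply [phi] to the Nijenhuis condition: [phi E = 0] kills the right-hand side, and the
    [E]-components left by [phi] squared add up to [phi X (eta Y)]. *)
Lemma phi_bracket X Y : eta X = 0 ->
  phi (bracket X Y + bracket (phi X) (phi Y))
  = bracket (phi X) Y + bracket X (phi Y) - phi X (eta Y) *: E.
Proof.
move=> X0; have := congr1 phi (nijenhuis_ker X Y X0).
rewrite !linearB !linearD linearZ /= phiE scaler0 !(almost_pc_sqr ac).
rewrite -(eta_bracket_phi_sum X Y X0).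
rewrite linearB linearZ /= phiE scaler0 subr0 => e.
apply/eqP; rewrite -subr_eq0 -e; apply/eqP/vfield_ext => f.
by rewrite !vfieldE; ring.
Qed.

Lemma eta_lieE X : eta (bracket E X) = E (eta X).
Proof.
have := congr1 (fun a : oneform M => a X) (normal_lie_eta nc).
by rewrite !oneformE => /eqP; rewrite subr_eq0 => /eqP.
Qed.

Lemma phi_lieE X : bracket E (phi X) = phi (bracket E X).
Proof. by apply/eqP; rewrite -subr_eq0; apply/eqP/(normal_lie_phi nc). Qed.

(** What [X] and [b] contribute to the form part of [W]; the inner sign is that of the block
    [- dual_endo phi]. *)
Definition twisted_lie X b := lie_form X b - lie_form (phi X) (dual_endo phi b).

(** Two terms [b (bracket E X)] cancel, because [bracket E] commutes with [phi] and [b] is unchanged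
    by [phi] squared. *)
Lemma twisted_lieE X b : b E = 0 -> twisted_lie X b E = 0.
Proof.
move=> b0; rewrite !oneformE phiE b0 oneform_app0 !vfield0.
rewrite !(bracket_antisym E) phi_lieE (raddfN phi) !oneform_appN.
by rewrite oneform_phi_sqr //; ring.
Qed.

(** Evaluated on [Y], this is [b] applied to [phi_bracket], whose [E]-term is killed by
    [b E = 0]. *)
Lemma twisted_lie_phi X b : eta X = 0 -> b E = 0 ->
  lie_form (phi X) b - lie_form X (dual_endo phi b)
  = - dual_endo phi (twisted_lie X b).
Proof.
move=> X0 b0; apply: oneform_ext => Y; rewrite !oneformE oneform_phi_sqr //.
have := congr1 b (phi_bracket X Y X0).
rewrite linearD !oneform_app b0 mulr0 subr0 => e.
have -> : b (bracket (phi X) Y) = b (phi (bracket X Y))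
  + b (phi (bracket (phi X) (phi Y))) - b (bracket X (phi Y)).
  by rewrite e addrK.
by ring.
Qed.

(** * The endomorphism on the kernel subbundle *)

Definition sum_endo s : gsection M := (phi s.1, - dual_endo phi s.2).
(** Together with [sum_endo], this specialises [gpc_ker] and [gpc_endo] to the associated structure,
    without the zero blocks. *)
Definition ker_pair s := eta s.1 = 0 /\ s.2 E = 0.

(** The exact terms of the two brackets cancel, as forms killing [E] are unchanged by [phi]
    squared. *)
Lemma courant_sum_endo s t : ker_pair s -> ker_pair t ->
  courant s t + courant (sum_endo s) (sum_endo t)
  = (bracket s.1 t.1 + bracket (phi s.1) (phi t.1),
     twisted_lie s.1 t.2 - twisted_lie t.1 s.2).
Proof.
move=> [s1 s2] [t1 t2]; congr pair; apply: oneform_ext => X.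
rewrite !oneformE [LHS]/= !oneform_phi_sqr // !(vfieldB, vfieldN).
by ring.
Qed.

(** Here the exact terms cancel by sign alone, and [twisted_lie_phi] rewrites the Lie
    derivatives. *)
Lemma courant_sum_endo_e s t : ker_pair s -> ker_pair t ->
  courant s (sum_endo t) + courant (sum_endo s) t
  = (bracket (phi s.1) t.1 + bracket s.1 (phi t.1),
     dual_endo phi (twisted_lie t.1 s.2) - dual_endo phi (twisted_lie s.1 t.2)).
Proof.
move=> [s1 s2] [t1 t2]; congr pair; first exact: addrC.
rewrite -(opprK (dual_endo phi (twisted_lie t.1 _))) -!twisted_lie_phi //.
apply: oneform_ext => X.
rewrite !oneformE [LHS]/= !(vfieldB, vfieldN).
by ring.
Qed.

(** The bracket condition of [para_graph_closed]: [eta_bracket_phi] and [twisted_lieE] give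
    membership in the kernel, [phi_bracket] the equality on fields. *)
Lemma courant_sum_endo_closed s t : ker_pair s -> ker_pair t ->
  ker_pair (courant s t + courant (sum_endo s) (sum_endo t)) /\
  courant s (sum_endo t) + courant (sum_endo s) t
  = sum_endo (courant s t + courant (sum_endo s) (sum_endo t)).
Proof.
move=> ks kt; rewrite courant_sum_endo_e // courant_sum_endo //.
have [[s1 s2] [t1 t2]] := (ks, kt); split.
  split.
    by rewrite oneform_app eta_bracket_phi // t1 vfield0 sub0r subrr.
  change ((twisted_lie s.1 t.2 - twisted_lie t.1 s.2) E = 0).
  by rewrite oneform_addE oneform_oppE !twisted_lieE // subrr.
congr pair; first by rewrite phi_bracket // t1 vfield0 scale0r subr0.
by apply: oneform_ext => X; rewrite !oneformE; ring.
Qed.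

Lemma sum_endo_linear : linear sum_endo.
Proof.
move=> f [X a] [Y b]; congr pair; first exact: linearP.
change (- dual_endo phi (f *: a + b)
  = f *: - dual_endo phi a - dual_endo phi b).
by apply: oneform_ext => Z; rewrite !oneformE; ring.
Qed.

Lemma sum_endoN s : sum_endo (- s) = - sum_endo s.
Proof.
case: s => X a; congr pair; first exact: raddfN.
change (- dual_endo phi (- a) = - - dual_endo phi a).
by apply: oneform_ext => Y; rewrite !oneformE.
Qed.

Lemma sum_endo0 : sum_endo 0 = 0.
Proof.
congr pair; first exact: raddf0.
change (- dual_endo phi (0 : oneform M) = 0).
by apply: oneform_ext => Y; rewrite !oneformE oppr0.
Qed.

Lemma sum_endo_ker s : ker_pair s -> ker_pair (sum_endo s).
Proof.
split; first exact: eta_phi.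
change ((- dual_endo phi s.2) E = 0).
by rewrite !oneformE phiE oneform_app0 oppr0.
Qed.

Lemma sum_endoK s : ker_pair s -> sum_endo (sum_endo s) = s.
Proof.
case: s => X a [/= X0 a0]; congr pair; first exact: phi_sqr_ker.
change (- dual_endo phi (- dual_endo phi a) = a).
by apply: oneform_ext => Y; rewrite !oneformE opprK oneform_phi_sqr.
Qed.

Lemma ker_pairP f s t : ker_pair s -> ker_pair t -> ker_pair (f *: s + t).
Proof.
move=> [s1 s2] [t1 t2]; split; rewrite !gsectionE ?oneformE ?oneform_app.
  by rewrite s1 t1 mulr0 addr0.
by rewrite s2 t2 mulr0 addr0.
Qed.

(** * Closure of the two graphs *)

Lemma para_graph_E_closed :
  courant_closed (para_graph (E, 0) ker_pair sum_endo).
Proof.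
(* The exact term of the bracket with [(E, 0)] vanishes on the kernel, leaving the Lie derivative
   along [E]. *)
apply: (para_graph_closed _ _ _ (fun s => (bracket E s.1, lie_form E s.2))).
- exact: ker_pairP.
- exact: sum_endo_linear.
- exact: sum_endo_ker.
- exact: sum_endoK.
(* The bracket of the fields [f *: E] and [g *: E]. *)
- move=> f g; exists (f * E g - g * E f); rewrite !pair_scaleE0 courantE.
  congr pair; last first.
    rewrite !lie_form0r !oneform_zeroE !subr0 differential_fun0.
    by rewrite scaler0 subr0.
  by apply: vfield_ext => h; rewrite !vfieldE !vfieldM; ring.
- move=> f [X a] [/= X0 a0].
  rewrite !pair_scaleE0 courantE gsection_pairD; congr pair.
    by rewrite bracketZl addrC scaleNr.
  rewrite lie_formZl a0 scale0r addr0 lie_form0r subr0.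
  rewrite oneform_appZ a0 mulr0 oneform_zeroE subr0 differential_fun0.
  by rewrite scaler0 subr0 add0r.
- move=> s [s1 s2]; split; first by rewrite eta_lieE s1 vfield0.
  by rewrite lie_formE s2 vfield0 bracket_diag oneform_app0 subr0.
- move=> s [s1 s2]; congr pair; first exact: phi_lieE.
  apply: oneform_ext => X.
  by rewrite !oneformE [LHS]/= vfieldN phi_lieE; ring.
- exact: courant_sum_endo_closed.
Qed.

(** On [Y] both sides equal [eta (bracket X (phi Y))], by [eta_bracket_phi_sum]. *)
Lemma lie_eta_phi X : eta X = 0 ->
  lie_form (phi X) eta = dual_endo phi (- lie_form X eta).
Proof.
move=> X0; apply: oneform_ext => Y; rewrite !oneformE eta_phi vfield0.
by rewrite -eta_bracket_phi_sum //; ring.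
Qed.

Lemma para_graph_eta_closed :
  courant_closed (para_graph (0, eta) ker_pair (fun s => - sum_endo s)).
Proof.
have FN s t : courant (- sum_endo s) t = - courant (sum_endo s) t.
  by rewrite courant_antisym courantNr opprK courant_antisym.
(* Bracketing [(0, eta)] with [s] gives only a form; its exact term vanishes as [eta s.1 = 0]. *)
apply: (para_graph_closed _ _ _ (fun s => (0, - lie_form s.1 eta))).
- exact: ker_pairP.
- by move=> f s t; rewrite sum_endo_linear opprD scalerN.
- move=> s ks; rewrite -scaleN1r -[_ *: _]addr0.
  by apply: ker_pairP; [exact: sum_endo_ker|split; rewrite ?oneform_app0].
- by move=> s ks; rewrite sum_endoN opprK sum_endoK.
(* Two 1-forms have zero Courant bracket. *)
- move=> f g; exists 0; rewrite !pair_scale0r courantE scale0r; congr pair.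
    exact: bracket0r.
  by rewrite !lie_form0l !oneform_app0 !subr0 differential_fun0 scaler0 subr0.
- move=> f [X a] [/= X0 a0].
  rewrite !pair_scale0r courantE gsection_pairD; congr pair.
    by rewrite bracket0l addr0.
  rewrite lie_form0l sub0r lie_formZr oneform_app0 oneform_scaleE X0 mulr0.
  by rewrite subr0 differential_fun0 scaler0 subr0 opprD scaleNr scalerN.
- move=> s [s1 s2]; split; first by rewrite oneform_app0.
  (* [X (eta E)] is the derivative of a constant, and [eta (bracket E X) = E (eta X) = 0]. *)
  rewrite oneform_oppE lie_formE etaE bracket_antisym oneform_appN eta_lieE s1.
  by rewrite vfield0 vfield1 !oppr0 addr0 oppr0.
- move=> [X a] [/= X0 a0]; congr pair.
    by rewrite -[RHS]/(- phi 0) raddf0 oppr0.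
  change (- lie_form (- phi X) eta
    = - - dual_endo phi (- lie_form X eta)).
  by rewrite -lie_eta_phi // lie_formNl.
- move=> s t ks kt.
  (* The signs cancel in the real part, while the e-part changes sign with [F]. *)
  rewrite !courantNr !FN opprK -opprD.
  have [kW ->] := courant_sum_endo_closed s t ks kt.
  by split.
Qed.

(** * The associated generalized structure *)

Lemma associated_gpc_endoE s :
  gpc_endo (associated_gpc phi E eta) s = sum_endo s.
Proof. by congr pair; [exact: addr0|exact: sub0r]. Qed.

(** The square condition is [almost_pc_sqr] on fields and its transpose on forms. *)
Lemma associated_gen_almost :
  gen_almost_paracontact (associated_gpc phi E eta).
Proof.
split; rewrite //.
- move=> [X a] [Y b]; rewrite !associated_gpc_endoE.
  change (half_fun M * (b (phi X) + (- dual_endo phi a) Y)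
    + half_fun M * ((- dual_endo phi b) X + a (phi Y)) = 0).
  by rewrite !oneformE; ring.
- rewrite associated_gpc_endoE; congr pair; first exact: raddf0.
  change (- dual_endo phi eta = 0).
  by apply: oneform_ext => X; rewrite !oneformE eta_phi oppr0.
- rewrite associated_gpc_endoE -[RHS]sum_endo0; congr pair.
  by rewrite -[RHS]/(phi 0) raddf0; exact: phiE.
- move=> [X a]; rewrite !associated_gpc_endoE; congr pair.
    exact: almost_pc_sqr ac X.
  change (- dual_endo phi (- dual_endo phi a) = a - (a E : C) *: eta).
  apply: oneform_ext => Y; rewrite !oneformE opprK (almost_pc_sqr ac).
  by rewrite !oneform_app mulrC.
Qed.

Lemma gpc_E10_endoE s :
  para_real s + para_e (para_map (gpc_endo (associated_gpc phi E eta))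
    (para_real s)) = (s, sum_endo s).
Proof.
rewrite /para_e /para_map /= !associated_gpc_endoE sum_endo0.
by congr pair; [exact: addr0|exact: add0r].
Qed.

Lemma gpc_E01_endoE s :
  para_real s - para_e (para_map (gpc_endo (associated_gpc phi E eta))
    (para_real s)) = (s, - sum_endo s).
Proof.
rewrite /para_e /para_map /= !associated_gpc_endoE sum_endo0.
by congr pair; [exact: subr0|exact: sub0r].
Qed.

Lemma gpc_L_closed : courant_closed (gpc_L (associated_gpc phi E eta)).
Proof.
move=> _ _ [_ [_ [[c ->] [s ks ->] ->]]] [_ [_ [[d ->] [t kt ->] ->]]].
rewrite !gpc_E10_endoE !para_line_addE.
(* The components of [c] and [d] serve as the coefficients along the line. *)
have [|| f [g [r [kr ->]]]] := para_graph_E_closed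
    (c.1 *: (E, 0) + s, c.2 *: (E, 0) + sum_endo s)
    (d.1 *: (E, 0) + t, d.2 *: (E, 0) + sum_endo t).
- by exists c.1, c.2, s.
- by exists d.1, d.2, t.
exists (para_scale (f, g) (para_real (E, 0))), (r, sum_endo r); split.
- by exists (f, g).
- by exists r; rewrite // gpc_E10_endoE.
- by rewrite para_line_addE.
Qed.

Lemma gpc_Lstar_closed : courant_closed (gpc_Lstar (associated_gpc phi E eta)).
Proof.
move=> _ _ [_ [_ [[c ->] [s ks ->] ->]]] [_ [_ [[d ->] [t kt ->] ->]]].
rewrite !gpc_E01_endoE !para_line_addE.
have [|| f [g [r [kr ->]]]] := para_graph_eta_closed
    (c.1 *: (0, eta) + s, c.2 *: (0, eta) - sum_endo s)
    (d.1 *: (0, eta) + t, d.2 *: (0, eta) - sum_endo t).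
- by exists c.1, c.2, s.
- by exists d.1, d.2, t.
exists (para_scale (f, g) (para_real (0, eta))), (r, - sum_endo r); split.
- by exists (f, g).
- by exists r; rewrite // gpc_E01_endoE.
- by rewrite para_line_addE.
Qed.

End Normal.

Theorem theorem5p1 (R : realType) (n : nat) (M : manifold R n.*2.+1)
    (phi : {linear vfield M -> vfield M}) (E : vfield M) (eta : oneform M) :
  almost_paracontact phi E eta -> normal_paracontact phi E eta ->
  strong_gen_paracontact (associated_gpc phi E eta).
Proof.
move=> ac nc; split; first exact: associated_gen_almost.
  exact: gpc_L_closed.
exact: gpc_Lstar_closed.
Qed.
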